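(* Let $n\ge1$, let $E\subset\mathbb{R}^{n+1}$ be a closed set and let $s\in(0,1/\sqrt{90})$ be fixed. Let $\mathcal{T}_n(E)\subset E$ be the set of all points $x\in E$ such that (1) there exists an $s$-approximate tangent $n$-plane $V_x$ for $E$ at $x$, and (2) $E$ satisfies the weak lower Ahlfors-David $n$-regularity condition at $x$. Then there exist two countable collections of bounded Lipschitz domains $\{\Omega_j^+\}_{j\ge1}$ and $\{\Omega_j^-\}_{j\ge1}$ in $\mathbb{R}^{n+1}$ such that, for every $j$, $\Omega_j^+\cap\Omega_j^-=\emptyset$ and $\mathcal{T}_n(E)\cap\partial\Omega_j^+=\mathcal{T}_n(E)\cap\partial\Omega_j^-$, and moreover $\mathcal{T}_n(E)\subset\bigcup_j\partial\Omega_j^+$ and $\mathcal{T}_n(E)\subset\bigcup_j\partial\Omega_j^-$.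
   Context: Notation: $B(x,r)$ is the open ball in $\mathbb{R}^d$; $\mathcal{H}^n$ is $n$-dimensional Hausdorff measure; $G(d,n)$ is the set of $n$-dimensional linear subspaces of $\mathbb{R}^d$. Here $d=n+1$. Weak lower Ahlfors-David $n$-regularity (WLADR) at $x$: a set $E\subset\mathbb{R}^d$ satisfies it at $x\in E$ if there is $\rho_x>0$ such that $$\inf\left\{\frac{\mathcal{H}^n(B(y,r)\cap E)}{r^n}: y\in B(x,\rho_x)\cap E,\ 0<r<\rho_x\right\}>0.$$ Cones: for $V\in G(d,n)$, $\xi\in\mathbb{R}^d$, $s\in(0,1)$, $X(\xi,V,s)=\{x\in\mathbb{R}^d:\operatorname{dist}(x-\xi,V)<s|x-\xi|\}$. $s$-approximate tangent: for fixed $s\in(0,1)$, $V\in G(d,n)$ is an $s$-approximate tangent $n$-plane for $E$ at $\xi$ if $\limsup_{r\to0}\mathcal{H}^n(E\cap B(\xi,r))/r^n>0$ and $\lim_{r\to 0} r^{-n}\mathcal{H}^n\big(E\cap B(\xi,r)\setminus X(\xi,V,s)\big)=0$. A bounded Lipschitz domain is a bounded connected open set whose boundary is locally, up to a rigid motion, the graph of a Lipschitz function, with the domain lying locally on one side of the graph. *)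

(* Defs.v *)
From HB Require Import structures.
From mathcomp Require Import all_boot all_order all_algebra.
From mathcomp Require Import all_classical all_reals all_analysis.

Set Implicit Arguments.
Unset Strict Implicit.
Unset Printing Implicit Defensive.

Import Order.TTheory GRing.Theory Num.Theory.
Import numFieldNormedType.Exports.

Local Open Scope classical_set_scope.
Local Open Scope ring_scope.

(* Points of R^d are row vectors.  The library norm on 'rV[R]_d is the max norm,
   so everything metric below goes through [enorm].  Topological notions (closed,
   open, connected, closure, interior) and boundedness do not depend on which of
   the two norms is used, and are taken from the library. *)
Definition enorm (R : realType) (d : nat) (x : 'rV[R]_d) : R :=
  Num.sqrt (\sum_(i < d) x 0 i ^+ 2).

Definition eball (R : realType) (d : nat) (x : 'rV[R]_d) (r : R) :
    set 'rV[R]_d :=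
  [set y | enorm (y - x) < r].

Definition frontier (T : topologicalType) (A : set T) : set T :=
  closure A `\` interior A.

(* -oo for the empty set, the usual extended-real diameter otherwise. *)
Definition ediam (R : realType) (d : nat) (A : set 'rV[R]_d) : \bar R :=
  ereal_sup [set (enorm (p.1 - p.2))%:E | p in A `*` A].

(* The empty set gets weight 0 (this also makes the 0-dimensional measure the
   counting measure). *)
Definition hausdorff_gauge (R : realType) (d n : nat) (A : set 'rV[R]_d) :
    \bar R :=
  if `[< A = set0 >] then 0%E else (ediam A ^+ n)%E.

Definition hausdorff_content (R : realType) (d n : nat) (delta : R)
    (A : set 'rV[R]_d) : \bar R :=
  ereal_inf [set (\sum_(0 <= i <oo) hausdorff_gauge n (U i))%E |
    U in [set U : nat -> set 'rV[R]_d |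
      (forall i, (ediam (U i) <= delta%:E)%E) /\ A `<=` \bigcup_i U i]].

(* H^n, with weight diam^n and no dimensional constant: all the conditions in
   which it is used below are invariant under multiplication of H^n by a
   positive constant.  The supremum over delta is the limit as delta -> 0. *)
Definition hausdorff_measure (R : realType) (d n : nat) (A : set 'rV[R]_d) :
    \bar R :=
  ereal_sup [set hausdorff_content n delta A | delta in [set delta : R | 0 < delta]].

Definition density_ratio (R : realType) (d n : nat) (A : set 'rV[R]_d) (r : R) :
    \bar R :=
  (hausdorff_measure n A * ((r ^+ n)^-1)%R%:E)%E.

Definition WLADR (R : realType) (d n : nat) (E : set 'rV[R]_d)
    (x : 'rV[R]_d) : Prop :=
  E x /\ exists rho : R, 0 < rho /\
    (0 < ereal_inf
      [set density_ratio n (eball p.1 p.2 `&` E) p.2 |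
        p in [set p : 'rV[R]_d * R |
          (eball x rho `&` E) p.1 /\ (0 < p.2 < rho)%R]])%E.

Definition dist_subspace (R : realType) (d : nat) (x : 'rV[R]_d)
    (V : {vspace 'rV[R]_d}) : R :=
  inf [set enorm (x - v) | v in [set v : 'rV[R]_d | v \in V]].

Definition cone (R : realType) (d : nat) (xi : 'rV[R]_d)
    (V : {vspace 'rV[R]_d}) (s : R) : set 'rV[R]_d :=
  [set x | dist_subspace (x - xi) V < s * enorm (x - xi)].

Definition approx_tangent (R : realType) (d n : nat) (s : R)
    (E : set 'rV[R]_d) (xi : 'rV[R]_d) (V : {vspace 'rV[R]_d}) : Prop :=
  [/\ \dim V = n,
      (0 < limf_esup (fun r : R => density_ratio n (E `&` eball xi r) r)
             (0%R : R)^'+)%E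
    & density_ratio n ((E `&` eball xi r) `\` cone xi V s) r
        @[r --> (0 : R)^'+] --> (0%E : \bar R)].

Definition tangent_points (R : realType) (d n : nat) (s : R)
    (E : set 'rV[R]_d) : set 'rV[R]_d :=
  [set x | [/\ E x,
               exists V : {vspace 'rV[R]_d}, approx_tangent n s E x V
             & WLADR n E x]].

(* First n coordinates; the last one is [y 0 ord_max]. *)
Definition horizontal (R : realType) (n : nat) (y : 'rV[R]_n.+1) : 'rV[R]_n :=
  \row_(i < n) y 0 (widen_ord (leqnSn n) i).

Definition lipschitz_fun (R : realType) (n : nat) (phi : 'rV[R]_n -> R) : Prop :=
  exists L : R, forall u v, `|phi u - phi v| <= L * enorm (u - v).

(* Reflections are allowed; in [lipschitz_domain] this is immaterial, since a
   reflection of the horizontal variables can be absorbed into [phi]. *)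
Definition rigid_motion (R : realType) (d : nat)
    (T : 'rV[R]_d -> 'rV[R]_d) : Prop :=
  exists (Q : 'M[R]_d) (b : 'rV[R]_d),
    Q *m Q^T = 1%:M /\ forall x, T x = x *m Q + b.

Definition lipschitz_domain (R : realType) (n : nat)
    (Omega : set 'rV[R]_n.+1) : Prop :=
  [/\ Omega !=set0, open Omega, connected Omega, bounded_set Omega &
      forall p, frontier Omega p ->
        exists (r : R) (T : 'rV[R]_n.+1 -> 'rV[R]_n.+1) (phi : 'rV[R]_n -> R),
          [/\ 0 < r, rigid_motion T, lipschitz_fun phi,
              eball p r `&` frontier Omega =
                eball p r `&` [set x | T x 0 ord_max = phi (horizontal (T x))]
            & eball p r `&` Omega =
                eball p r `&` [set x | phi (horizontal (T x)) < T x 0 ord_max]]].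

(* Main.v *)
Require Import Defs.
From HB Require Import structures.
From mathcomp Require Import all_boot all_order all_algebra.
From mathcomp Require Import all_classical all_reals all_analysis.
From mathcomp Require Import ring lra.
Import Order.TTheory GRing.Theory Num.Theory.
Import numFieldNormedType.Exports.
Local Open Scope classical_set_scope.
Local Open Scope ring_scope.

(** Let T be the set of points to cover.  At a point x of T the tangent plane, of
    unit normal nu, confines E near x to the cone
    |<y - x, nu>| <= |y - x| / 8: a point y of E outside that cone would,
    by lower regularity, bring a ball of radius comparable to |y - x| in which E
    has measure at least a fixed multiple of |y - x| ^ n and which misses the
    narrower cone of the tangent condition ([tangent_point_flat]).  The radius
    at which this confinement starts and the normal depend on x, but cutting T according
    to a lower bound 1 / (k + 1) for the radius and to grids for x and for nu
    leaves countably many pieces K on which one radius r serves all points, one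
    normal serves up to the weaker slope 1 / 6, and the diameter is at most r / 8.

    For such a K with base point x0, join every point of K to a small ball
    centred at x0 + (r / 2) nu.  The union of these open ice-cream cones is a
    domain above K; the point x0 - (r / 2) nu gives a domain below.  All
    directions in the cones are steep while E is flat as seen from K, so the
    domains avoid E and each other, and a point of E in the frontier of either
    domain can only be a limit of vertices.  Thus both frontiers meet E exactly
    in the closure of K, which gives the equality of the traces on T and the
    covering of T at the same time ([horn_frontier], [two_sided_domains]).

    That these unions have Lipschitz boundary costs nothing more: they are
    star-shaped with respect to every point of a ball, and a bounded open set
    with this property is locally the region above a Lipschitz graph in the
    direction of the centre of the ball ([star_shaped_lipschitz]). *)

Set Implicit Arguments.
Unset Strict Implicit.
Unset Printing Implicit Defensive.

(** * Euclidean geometry of row vectors *)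

Section EuclideanGeometry.
Context {R : realType} {d : nat}.
Implicit Types (x y z u v : 'rV[R]_d) (a b c e : R) (A : set 'rV[R]_d).

Definition dot x y : R := \sum_(i < d) x 0 i * y 0 i.

Lemma dot_mulmx x y : dot x y = (x *m y^T) 0 0.
Proof. by rewrite mxE; apply: eq_bigr => i _; rewrite mxE. Qed.

Lemma dotC x y : dot x y = dot y x.
Proof. by apply: eq_bigr => i _; rewrite mulrC. Qed.

Lemma dotDl x y z : dot (x + y) z = dot x z + dot y z.
Proof. by rewrite -big_split; apply: eq_bigr => i _; rewrite mxE mulrDl. Qed.

Lemma dotZl a x y : dot (a *: x) y = a * dot x y.
Proof. by rewrite mulr_sumr; apply: eq_bigr => i _; rewrite mxE mulrA. Qed.

Lemma dotNl x y : dot (- x) y = - dot x y.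
Proof. by rewrite -scaleN1r dotZl mulN1r. Qed.

Lemma dotBl x y z : dot (x - y) z = dot x z - dot y z.
Proof. by rewrite dotDl dotNl. Qed.

Lemma dotDr x y z : dot x (y + z) = dot x y + dot x z.
Proof. by rewrite !(dotC x) dotDl. Qed.

Lemma dotZr a x y : dot x (a *: y) = a * dot x y.
Proof. by rewrite !(dotC x) dotZl. Qed.

Lemma dotNr x y : dot x (- y) = - dot x y.
Proof. by rewrite !(dotC x) dotNl. Qed.

Lemma dotBr x y z : dot x (y - z) = dot x y - dot x z.
Proof. by rewrite dotDr dotNr. Qed.

Lemma dot_ge0 x : 0 <= dot x x.
Proof. by apply: sumr_ge0 => i _; rewrite -expr2 sqr_ge0. Qed.

Lemma enorm_ge0 x : 0 <= enorm x.
Proof. exact: sqrtr_ge0. Qed.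

Lemma sqr_enorm x : enorm x ^+ 2 = dot x x.
Proof. by rewrite sqr_sqrtr //; exact: dot_ge0. Qed.

Lemma enormE x : enorm x = Num.sqrt (dot x x).
Proof. by []. Qed.

Lemma enorm0 : enorm (0 : 'rV[R]_d) = 0.
Proof. by rewrite enormE -(scale0r 0) dotZl mul0r sqrtr0. Qed.

Lemma enormZ a x : enorm (a *: x) = `|a| * enorm x.
Proof.
by rewrite !enormE dotZl dotZr mulrA -expr2 sqrtrM ?sqr_ge0 // sqrtr_sqr.
Qed.

Lemma enormN x : enorm (- x) = enorm x.
Proof. by rewrite -scaleN1r enormZ normrN1 mul1r. Qed.

Lemma enorm_distC x y : enorm (x - y) = enorm (y - x).
Proof. by rewrite -enormN opprB. Qed.

Lemma enorm_gt0 x : (0 < enorm x) = (x != 0).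
Proof.
rewrite lt_def enorm_ge0 andbT; congr (~~ _).
apply/eqP/eqP => [x0|->]; last exact: enorm0.
have /eqP : dot x x = 0 by rewrite -sqr_enorm x0 expr0n.
rewrite psumr_eq0 => [/allP x0i|i _]; last by rewrite -expr2 sqr_ge0.
apply/rowP => i; rewrite mxE.
by have := x0i i (mem_index_enum i); rewrite /= mulf_eq0 orbb => /eqP.
Qed.

(** Expanding |(|y|^2) x - <x,y> y|^2 >= 0. *)
Lemma cauchy_schwarz x y : `|dot x y| <= enorm x * enorm y.
Proof.
have [->|y0] := eqVneq y 0.
  by rewrite enorm0 mulr0 -(scale0r 0) dotZr mul0r normr0.
have yy : 0 < dot y y by rewrite -sqr_enorm exprn_gt0// enorm_gt0.
rewrite -ler_sqr ?nnegrE ?mulr_ge0 ?enorm_ge0 //.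
rewrite exprMn !sqr_enorm real_normK ?num_real //.
have : 0 <= dot (dot y y *: x - dot x y *: y) (dot y y *: x - dot x y *: y).
  exact: dot_ge0.
rewrite !(dotBl, dotBr, dotZl, dotZr) (dotC y x).
rewrite (_ : _ - _ = dot y y * (dot x x * dot y y - dot x y ^+ 2)); last by ring.
by rewrite pmulr_rge0 // subr_ge0.
Qed.

Lemma ler_enormD x y : enorm (x + y) <= enorm x + enorm y.
Proof.
rewrite -ler_sqr ?nnegrE ?addr_ge0 ?enorm_ge0 //.
rewrite sqr_enorm sqrrD !sqr_enorm dotDl !dotDr (dotC y x).
have := le_trans (ler_norm _) (cauchy_schwarz x y); lra.
Qed.

Lemma ler_enormB x y z : enorm (x - z) <= enorm (x - y) + enorm (y - z).
Proof. by have := ler_enormD (x - y) (y - z); rewrite subrKA. Qed.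

Lemma ler_coord_enorm x i : `|x 0 i| <= enorm x.
Proof.
rewrite -ler_sqr ?nnegrE ?enorm_ge0 // real_normK ?num_real // sqr_enorm.
rewrite /dot (bigD1 i) //= -expr2 lerDl.
by apply: sumr_ge0 => j _; rewrite -expr2 sqr_ge0.
Qed.

Lemma enorm_le_coord x c : 0 <= c -> (forall i, `|x 0 i| <= c) ->
  enorm x <= d.+1%:R * c.
Proof.
move=> c0 xc; rewrite -ler_sqr ?nnegrE ?enorm_ge0 ?mulr_ge0 // sqr_enorm.
apply: (@le_trans _ _ (d%:R * c ^+ 2)).
  rewrite -[d in d%:R]card_ord mulr_natl -sumr_const; apply: ler_sum => i _.
  by rewrite -expr2 -real_normK ?num_real // ler_sqr ?nnegrE.
rewrite exprMn ler_wpM2r ?sqr_ge0 // -natrX ler_nat.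
exact: leq_trans (leqnSn d) (leq_pmulr _ _).
Qed.

(** * The Euclidean norm and the topology *)

Lemma nbhs_eball x A : nbhs x A <-> exists2 e, 0 < e & eball x e `<=` A.
Proof.
split=> [/nbhs_ballP[e /= e0 eA]|[e e0 eA]].
  exists e => // y xy; apply: eA; split=> // i j.
  rewrite /ball /= ord1 distrC; apply: le_lt_trans xy.
  by have := ler_coord_enorm (y - x) j; rewrite !mxE.
apply/nbhs_ballP; exists (e / (d.+2)%:R) => /=; first by rewrite divr_gt0.
move=> y [_ xy]; apply: eA; rewrite /eball /=.
apply: (@le_lt_trans _ _ (d.+1%:R * (e / (d.+2)%:R))).
  apply: enorm_le_coord => [|i]; first by rewrite divr_ge0 // ltW.
  by have := ltW (xy 0 i); rewrite !mxE distrC.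
by rewrite mulrCA gtr_pMr // ltr_pdivrMr // mul1r ltr_nat.
Qed.

Lemma closure_eball A x :
  closure A x <-> forall e, 0 < e -> exists2 y, A y & enorm (y - x) < e.
Proof.
split=> [clA e e0|h B /nbhs_eball[e e0 eB]].
  have [|y [Ay xy]] := clA (eball x e); first by apply/nbhs_eball; exists e.
  by exists y.
by have [y Ay yx] := h e e0; exists y; split=> //; exact: eB.
Qed.

Lemma open_frontier A : open A -> frontier A = closure A `\` A.
Proof. by move=> /interior_id oA; rewrite /frontier oA. Qed.

Lemma bounded_enorm A c : (forall x, A x -> enorm x <= c) -> bounded_set A.
Proof.
move=> Ac; exists c; split; first exact: num_real.
move=> M cM x /Ac xc; apply: le_trans (ltW cM).
rewrite [`|_|]mx_normrE; apply/bigmax_leP; split.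
  exact: le_trans (enorm_ge0 x) xc.
by move=> [i j] _ /=; rewrite ord1; exact: le_trans (ler_coord_enorm x j) xc.
Qed.

End EuclideanGeometry.

(** * Domains that are star-shaped with respect to a ball *)

Section StarShaped.
Context {R : realType}.

Lemma sqr_enorm_horizontal n (y : 'rV[R]_n.+1) :
  enorm y ^+ 2 = enorm (horizontal y) ^+ 2 + y 0 ord_max ^+ 2.
Proof.
rewrite !sqr_enorm /dot big_ord_recr /= -expr2; congr (_ + _).
by apply: eq_bigr => i _; rewrite !mxE.
Qed.

Lemma horizontalB n (x y : 'rV[R]_n.+1) :
  horizontal (x - y) = horizontal x - horizontal y.
Proof. by apply/rowP => i; rewrite !mxE. Qed.

Lemma enorm_orthogonal d (Q : 'M[R]_d) (x : 'rV[R]_d) :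
  Q *m Q^T = 1%:M -> enorm (x *m Q) = enorm x.
Proof.
move=> QQ; rewrite !enormE !dot_mulmx trmx_mul.
by rewrite mulmxA -(mulmxA x) QQ mulmx1.
Qed.

(** The Householder reflection in the hyperplane orthogonal to the difference
    of e and the last basis vector exchanges these two unit vectors. *)
Lemma orthogonal_last_coord n (e : 'rV[R]_n.+1) : enorm e = 1 ->
  exists Q : 'M[R]_n.+1, Q *m Q^T = 1%:M /\
    forall x : 'rV[R]_n.+1, (x *m Q) 0 ord_max = dot x e.
Proof.
move=> e1; pose l : 'rV[R]_n.+1 := delta_mx 0 ord_max.
have dotl x : dot x l = x 0 ord_max.
  rewrite /dot (bigD1 ord_max) //= big1 => [|i /negPf il].
    by rewrite addr0 mxE !eqxx mulr1.
  by rewrite mxE il mulr0.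
have ee : dot e e = 1 by rewrite -sqr_enorm e1 expr1n.
have ll : dot l l = 1 by rewrite dotl mxE !eqxx.
pose u := e - l; pose P := u^T *m u; pose c := 2 / dot u u.
have PP : P *m P = dot u u *: P.
  rewrite /P mulmxA -(mulmxA u^T u) [u *m u^T]mx11_scalar -dot_mulmx.
  by rewrite mul_mx_scalar -scalemxAl.
have uu : dot u u = 2 - 2 * dot e l.
  by rewrite !(dotBl, dotBr) ee ll (dotC l e); ring.
(* For e = l the inverse of 0 makes c = 0, and Q is the identity. *)
exists (1%:M - c *: P); split.
  have -> : (1%:M - c *: P)^T = 1%:M - c *: P.
    by rewrite linearB linearZ /= trmx1 trmx_mul trmxK.
  rewrite mulmxBl mul1mx mulmxBr mulmx1 -scalemxAl -scalemxAr PP !scalerA.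
  have [u0|u0] := eqVneq u 0.
    by rewrite /P u0 mulmx0 !scaler0 !subr0.
  have u1 : dot u u != 0 by rewrite -sqr_enorm expf_neq0 // gt_eqF // enorm_gt0.
  rewrite (_ : c * c * dot u u = 2 * c); last by rewrite /c; field.
  by rewrite mulr_natl mulr2n scalerDl opprB addrK subrK.
move=> x; rewrite mulmxBr mulmx1 -scalemxAr mulmxA [x *m u^T]mx11_scalar.
rewrite -dot_mulmx mul_scalar_mx scalerA -dotl dotBl dotZl.
have [u0|u0] := eqVneq u 0.
  by rewrite u0 -(scale0r 0) dotZl mul0r mulr0 subr0 (subr0_eq u0).
have u1 : dot u u != 0 by rewrite -sqr_enorm expf_neq0 // gt_eqF // enorm_gt0.
have -> : dot u l = - (dot u u / 2) by rewrite uu dotBl ll; field.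
rewrite (_ : c * _ * _ = - dot x u); last by rewrite /c; field.
by rewrite opprK dotBr; ring.
Qed.

(** The largest L-Lipschitz function below the points (h q, a q), q in S. *)
Definition lipschitz_envelope (I : Type) n (S : set I) (h : I -> 'rV[R]_n)
    (a : I -> R) (L : R) (u : 'rV[R]_n) : R :=
  inf [set a q + L * enorm (u - h q) | q in S].

Section Envelope.
Variables (I : Type) (n : nat) (S : set I) (h : I -> 'rV[R]_n).
Variables (a : I -> R) (L m : R).
Hypotheses (S0 : S !=set0) (L0 : 0 <= L) (am : forall q, S q -> m <= a q).
Local Notation phi := (lipschitz_envelope S h a L).

Lemma envelope_has_inf u : has_inf [set a q + L * enorm (u - h q) | q in S].
Proof.
split; first by have [q Sq] := S0; eexists; exists q.
exists m => _ [q Sq <-]; apply: le_trans (am Sq) _.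
by rewrite lerDl mulr_ge0 // enorm_ge0.
Qed.

Lemma envelope_le q u : S q -> phi u <= a q + L * enorm (u - h q).
Proof.
by move=> Sq; apply: ge_inf; [have [] := envelope_has_inf u | exists q].
Qed.

Lemma envelope_lt u c : phi u < c ->
  exists2 q, S q & a q + L * enorm (u - h q) < c.
Proof.
move=> uc; have [|_ [q Sq <-] qc] :=
  inf_adherent (_ : 0 < c - phi u) (envelope_has_inf u).
  by rewrite subr_gt0.
by exists q => //; rewrite subrKC in qc.
Qed.

Lemma envelope_lipschitz : lipschitz_fun phi.
Proof.
have half u v : phi u - phi v <= L * enorm (u - v).
  rewrite lerBlDr -lerBlDl; apply: lb_le_inf.
    by have [] := envelope_has_inf v.
  move=> _ [q Sq <-]; rewrite lerBlDl; apply: le_trans (envelope_le u Sq) _.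
  rewrite addrCA lerD2l -mulrDr ler_wpM2l //; exact: ler_enormB.
exists L => u v; rewrite ler_norml half andbT lerNl opprB enorm_distC.
exact: half.
Qed.
End Envelope.

Definition star_shaped_wrt d (B Omega : set 'rV[R]_d) : Prop :=
  forall b y t, B b -> Omega y -> 0 <= t <= 1 -> Omega (y + t *: (b - y)).

Lemma star_shaped_connected d (z : 'rV[R]_d) B Omega : B z ->
  star_shaped_wrt B Omega -> connected Omega.
Proof.
move=> Bz star; pose seg y := [set y + t *: (z - y) | t in `[0%R, 1%R]].
have -> : Omega = \bigcup_(y in Omega) seg y.
  apply/seteqP; split=> [y Oy|_ [y Oy [t t01 <-]]].
    by exists y => //; exists 0; rewrite ?scale0r ?addr0 //= in_itv /= lexx ler01.
  by apply: (star z) => //; rewrite /= in_itv in t01.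
apply: bigcup_connected => [|y Oy].
  exists z => y Oy; exists 1; first by rewrite /= in_itv /= lexx ler01.
  by rewrite scale1r subrKC.
apply: connected_continuous_connected; first exact: segment_connected.
apply: continuous_subspaceT => t.
by apply: cvgD; [exact: cvg_cst | apply: cvgZr_tmp; exact: cvg_id].
Qed.

(** Let p be a frontier point, e the unit vector from p to the centre z of the
    ball and D = |z - p|.  Seen from a point q of the domain near p, the ball of
    radius rho around z fills at least the ball of radius rho / 2 around q + D e,
    so the domain contains the points y with
    (2 D / rho) |horizontal part of y - q| < <y - q, e> <= D.
    Hence near p the domain is what lies above the lower envelope of upward
    cones of slope 2 D / rho with vertices at the points of the domain. *)
Lemma star_shaped_lipschitz n (z : 'rV[R]_n.+1) rho (Omega : set 'rV[R]_n.+1) :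
  0 < rho -> Omega !=set0 -> open Omega -> bounded_set Omega ->
  star_shaped_wrt (eball z rho) Omega -> lipschitz_domain Omega.
Proof.
move=> rho0 Omega0 oOmega bOmega star.
have zz : eball z rho z by rewrite /eball /= subrr enorm0.
split=> //; first exact: star_shaped_connected zz star.
rewrite (open_frontier oOmega) => p [clp Np].
set D := enorm (z - p).
have D0 : 0 < D.
  rewrite enorm_gt0 subr_eq0; apply: contra_notN Np => /eqP <-.
  have [y Oy] := Omega0.
  by have := star _ _ 1 zz Oy; rewrite scale1r subrKC; apply; rewrite ler01 lexx.
have rhoD : rho <= D.
  rewrite leNgt; apply/negP => Drho; apply: Np; have [y Oy] := Omega0.
  have := star p _ 1 _ Oy; rewrite scale1r subrKC; apply; rewrite ?ler01 ?lexx//.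
  by rewrite /eball /= enorm_distC.
have [e [e1 De]] : exists e, enorm e = 1 /\ D *: e = z - p.
  exists (D^-1 *: (z - p)); rewrite enormZ gtr0_norm ?invr_gt0//.
  by rewrite mulVf ?scalerA ?divff ?scale1r// gt_eqF.
have [Q [QQ lastQ]] := orthogonal_last_coord e1.
pose h y : 'rV[R]_n := horizontal (y *m Q); pose a y := dot y e.
have hB x y : h (x - y) = h x - h y by rewrite /h mulmxBl horizontalB.
have aB x y : a (x - y) = a x - a y by rewrite /a dotBl.
have aD x y : a (x + y) = a x + a y by rewrite /a dotDl.
have ae c : a (c *: e) = c.
  by rewrite /a dotZl -sqr_enorm e1 expr1n mulr1.
have ale y : `|a y| <= enorm y.
  by apply: le_trans (cauchy_schwarz _ _) _; rewrite e1 mulr1.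
have pyth y : enorm (y - a y *: e) = enorm (h y).
  apply/eqP; rewrite -(@eqrXn2 _ 2) ?enorm_ge0//; apply/eqP.
  have := sqr_enorm_horizontal (y *m Q).
  rewrite enorm_orthogonal // lastQ -/(a y) -/(h y) => /(canLR (addrK _)) <-.
  rewrite !sqr_enorm !(dotBl, dotBr, dotZl, dotZr) (dotC e) -/(a y).
  by rewrite -(sqr_enorm e) e1; ring.
have he y c : h (y + c *: e) = h y.
  apply/eqP; rewrite -subr_eq0 -hB addrC addKr -[_ == 0]negbK -enorm_gt0 -pyth.
  by rewrite ae subrr enorm0 ltxx.
have hle y : enorm (h y) <= enorm y.
  rewrite -ler_sqr ?nnegrE ?enorm_ge0// -(enorm_orthogonal y QQ).
  by rewrite sqr_enorm_horizontal lerDl sqr_ge0.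
pose L := 2 * D / rho.
have L0 : 0 < L by rewrite !mulr_gt0 ?invr_gt0.
have up q y : Omega q -> eball p (rho / 2) q -> a (y - q) <= D ->
    a q + L * enorm (h y - h q) < a y -> Omega y.
  rewrite -ltrBrDl -hB -aB => Oq pq avD; set v := y - q => ha.
  have av0 : 0 < a v by apply: le_lt_trans ha; rewrite mulr_ge0 ?enorm_ge0 ?ltW.
  (* Prolonged to height D, the chord from q to y ends in B(z, rho). *)
  have -> : y = q + (a v / D) *: ((q + (D / a v) *: v) - q).
    rewrite [q + _ - q]addrC addKr scalerA.
    have -> : a v / D * (D / a v) = 1 by field; rewrite !gt_eqF.
    by rewrite scale1r subrKC.
  apply: star => //; last first.
    by rewrite divr_ge0 ?(ltW av0) ?(ltW D0)//= ler_pdivrMr// mul1r.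
  rewrite /eball /=.
  have -> : q + (D / a v) *: v - z = (q - p) + (D / a v) *: (v - a v *: e).
    rewrite (scalerBr _ v) scalerA divfK ?gt_eqF// De opprB.
    rewrite -!addrA; congr (q + _); rewrite [RHS]addrC -!addrA.
    by congr (_ + _); rewrite [RHS]addrC subrK.
  apply: le_lt_trans (ler_enormD _ _) _.
  rewrite enormZ pyth gtr0_norm ?divr_gt0// (splitr rho); apply: ltrD => //.
  rewrite mulrAC ltr_pdivrMr// mulrC -ltr_pdivlMr//.
  have -> : rho / 2 * a v / D = a v / L.
    by rewrite /L; field; rewrite !gt_eqF.
  by rewrite ltr_pdivlMr// mulrC.
pose S := Omega `&` eball p (rho / 2).
have near_p r : 0 < r -> exists2 q, S q & enorm (q - p) < r.
  move=> r0; move/closure_eball: clp => /(_ (Num.min r (rho / 2))).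
  rewrite lt_min r0 divr_gt0// => /(_ isT)[q Oq].
  by rewrite lt_min => /andP[qr qrho]; exists q.
have S0 : S !=set0 by have [q Sq _] := near_p _ ltr01; exists q.
have am q : S q -> a p - rho / 2 <= a q.
  move=> [_ /ltW pq]; rewrite lerBlDl -lerBlDr -aB.
  by apply: le_trans pq; apply: le_trans (ler_norm _) _; rewrite enorm_distC.
pose phi := lipschitz_envelope S h a L.
have above y : Omega y -> eball p (rho / 2) y -> phi (h y) < a y.
  move=> Oy py; have [r r0 rO] : exists2 r, 0 < r & eball y r `<=` S.
    apply/nbhs_eball; apply: filterI; first by apply: open_nbhs_nbhs; split.
    apply/nbhs_eball; exists (rho / 2 - enorm (y - p)); first by rewrite subr_gt0.
    move=> w; rewrite /eball /= => wy.
    by rewrite (le_lt_trans (ler_enormB w y p)) // -ltrBrDr.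
  have Sw : S (y + (- (r / 2)) *: e).
    apply: rO; rewrite /eball /= addrAC subrr add0r enormZ e1 mulr1 normrN.
    by rewrite gtr0_norm ?divr_gt0// gtr_pMr// invf_lt1// ltr1n.
  apply: le_lt_trans (envelope_le h S0 (ltW L0) am (h y) Sw) _.
  by rewrite he subrr enorm0 mulr0 addr0 aD ae gtrDl oppr_lt0 divr_gt0.
have below y : eball p (rho / 2) y -> phi (h y) < a y -> Omega y.
  move=> py; case/(envelope_lt S0 (ltW L0) am) => q [Oq pq]; apply: (up) => //.
  apply: le_trans (ler_norm _) _; apply: le_trans (ale _) _.
  apply: le_trans (ler_enormB y p q) _; rewrite (enorm_distC p).
  by move: py pq; rewrite /eball /=; lra.
exists (rho / 2), (fun x => x *m Q), phi; split.
- by rewrite divr_gt0.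
- by exists Q, 0; split=> // x; rewrite addr0.
- exact: (envelope_lipschitz h S0 (ltW L0) am).
- apply/seteqP; split=> y [py Hy]; split=> //;
    rewrite /= ?lastQ -/(h y) -/(a y) in Hy *.
    case: Hy => cly Ny.
    apply/eqP; rewrite eq_le; apply/andP; split.
      by rewrite leNgt; apply/negP => /(below _ py).
    rewrite leNgt; apply/negP; rewrite -subr_gt0 => c0.
    have gap0 : 0 < rho / 2 - enorm (y - p) by rewrite subr_gt0.
    move/closure_eball: cly => /(_ (Num.min (rho / 2 - enorm (y - p))
      ((phi (h y) - a y) / (1 + L)))).
    rewrite lt_min gap0 divr_gt0 ?(addr_gt0 ltr01 L0)// => /(_ isT)[q Oq].
    rewrite lt_min ltr_pdivlMr ?(addr_gt0 ltr01 L0)// => /andP[qp qc].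
    have Sq : S q.
      split=> //; apply: le_lt_trans (ler_enormB q y p) _.
      by rewrite -ltrBrDr.
    have := envelope_le h S0 (ltW L0) am (h y) Sq; rewrite -/phi.
    have := le_trans (ler_norm _) (ale (q - y)); rewrite aB.
    have := ler_wpM2l (ltW L0) (hle (y - q)); rewrite hB (enorm_distC y).
    lra.
  split=> [|/above /(_ py)]; last first.
    by rewrite Hy ltxx.
  apply/closure_eball => r r0.
  set c := Num.min r (rho / 2 - enorm (y - p)).
  have c0 : 0 < c by rewrite lt_min r0 subr_gt0.
  have wy : enorm (y + (c / 2) *: e - y) < c.
    rewrite addrAC subrr add0r enormZ e1 mulr1 gtr0_norm ?divr_gt0//.
    by rewrite gtr_pMr// invf_lt1// ltr1n.
  move: (wy); rewrite {2}/c lt_min => /andP[wr wp].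
  exists (y + (c / 2) *: e) => //; apply: below.
    by apply: le_lt_trans (ler_enormB _ y _) _; rewrite -ltrBrDr.
  by rewrite he -Hy aD ae ltrDl divr_gt0.
- apply/seteqP; split=> y [py Hy]; split=> //;
    rewrite /= ?lastQ -/(h y) -/(a y) in Hy *.
    exact: above.
  exact: below.
Qed.

End StarShaped.

(** * Two domains touching a flat piece of a set from both sides *)

(** A union of ice-cream cones: the vertices, points of K, are left out, which
    makes the set open and lets K lie on its frontier. *)
Definition horn (R : realType) d (K : set 'rV[R]_d) (z : 'rV[R]_d) (rho : R) :
    set 'rV[R]_d :=
  [set y | exists x b t,
    [/\ K x, eball z rho b, 0 < t <= 1 & y = x + t *: (b - x)]].

Section Horn.
Context {R : realType} {d : nat}.
Implicit Types (K : set 'rV[R]_d) (x y z b : 'rV[R]_d).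

Lemma horn_open K z rho : open (horn K z rho).
Proof.
rewrite openE => _ [x [b [t [Kx bz /andP[t0 t1] ->]]]].
apply/nbhs_eball; exists (t * (rho - enorm (b - z))).
  by rewrite mulr_gt0 // subr_gt0.
move=> y; rewrite /eball /= => xy.
exists x, (b + t^-1 *: (y - (x + t *: (b - x)))), t; split=> //.
- rewrite /eball /= addrAC; apply: le_lt_trans (ler_enormD _ _) _.
  by rewrite enormZ gtr0_norm ?invr_gt0// -ltrBrDl mulrC ltr_pdivrMr// mulrC.
- by rewrite t0.
- rewrite [b + _ - x]addrAC scalerDr scalerA divff ?gt_eqF// scale1r.
  by rewrite addrA subrKC.
Qed.

(** Every single cone is convex and contains the ball; the new parameter u is
    the total weight that the combined point gives to the ball. *)
Lemma horn_star_shaped K z rho :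
  star_shaped_wrt (eball z rho) (horn K z rho).
Proof.
move=> b' _ t' b'z [x [b [t [Kx bz /andP[t0 t1] ->]]]] /andP[t'0 t'1].
set u := (1 - t') * t + t'.
have u0 : 0 < u.
  have [t'e|t'n1] := eqVneq t' 1; first by rewrite /u t'e subrr mul0r add0r.
  by rewrite ltr_pwDl// mulr_gt0// subr_gt0 lt_neqAle t'n1.
have u1 : u <= 1.
  by rewrite /u -lerBrDr ler_piMr// subr_ge0.
pose c := u^-1 *: (((1 - t') * t) *: b + t' *: b').
have uc : u *: c = ((1 - t') * t) *: b + t' *: b'.
  by rewrite /c scalerA divff ?scale1r// gt_eqF.
exists x, c, u; split=> //; last 2 first.
- by rewrite u0.
- rewrite (scalerBr u) uc.
  by apply/rowP => i; rewrite /u !mxE; ring.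
rewrite /eball /= -(ltr_pM2l u0) -{1}(gtr0_norm u0) -enormZ (scalerBr u) uc.
have -> : ((1 - t') * t) *: b + t' *: b' - u *: z =
    ((1 - t') * t) *: (b - z) + t' *: (b' - z).
  by apply/rowP => i; rewrite /u !mxE; ring.
apply: le_lt_trans (ler_enormD _ _) _; rewrite !enormZ (ger0_norm t'0).
rewrite ger0_norm ?mulr_ge0 ?subr_ge0 ?(ltW t0)//.
have [t'z|t'z] := eqVneq t' 0.
  by rewrite t'z mul0r addr0 subr0 mul1r /u t'z subr0 mul1r addr0 ltr_pM2l.
rewrite /u [ltRHS]mulrDl; apply: ler_ltD.
  by rewrite ler_wpM2l ?mulr_ge0 ?subr_ge0 ?(ltW t0)// ltW.
by rewrite ltr_pM2l// lt_def t'z.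
Qed.

End Horn.

Section FlatPiece.
Context {R : realType} {n : nat}.
Variables (E K : set 'rV[R]_n.+1) (x0 nu : 'rV[R]_n.+1) (r : R).
Hypotheses (r0 : 0 < r) (nu1 : enorm nu = 1) (K0 : K !=set0).
Hypothesis Kx0 : forall x, K x -> enorm (x - x0) <= r / 8.
Hypothesis flat : forall x y, K x -> E y -> enorm (y - x) < r ->
  `|dot (y - x) nu| <= enorm (y - x) / 6.

Let Omega := horn K (x0 + (r / 2) *: nu) (r / 8).

Let rho0 : 0 < r / 8. Proof. by rewrite divr_gt0. Qed.

Let dot_nu v : `|dot v nu| <= enorm v.
Proof. by apply: le_trans (cauchy_schwarz _ _) _; rewrite nu1 mulr1. Qed.

(** The radius r / 8 makes every chord from K to the ball make an angle of
    cosine at least 1 / 3 with nu, twice the slope 1 / 6 allowed to E. *)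
Lemma horn_steep y : Omega y -> exists x,
  [/\ K x, 0 < dot (y - x) nu, enorm (y - x) <= 3 * dot (y - x) nu
    & enorm (y - x) <= 3 / 4 * r].
Proof.
move=> [x [b [t [Kx bz /andP[t0 t1] ->]]]]; exists x.
rewrite [x + _ - x]addrAC subrr add0r enormZ dotZl (gtr0_norm t0).
have -> : b - x = (b - (x0 + (r / 2) *: nu)) - (x - x0) + (r / 2) *: nu.
  by apply/rowP => i; rewrite !mxE; ring.
set v := b - _; set w := x - x0.
have nn : dot nu nu = 1 by rewrite -sqr_enorm nu1 expr1n.
have dv : `|dot v nu| < r / 8 by apply: le_lt_trans (dot_nu v) bz.
have dw : `|dot w nu| <= r / 8 by apply: le_trans (dot_nu w) (Kx0 Kx).
have lb : r / 4 <= dot (v - w + (r / 2) *: nu) nu.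
  rewrite dotDl dotZl nn mulr1 (dotBl v).
  by move: dv dw; rewrite ltr_norml ler_norml => /andP[? ?] /andP[? ?]; lra.
have ub : enorm (v - w + (r / 2) *: nu) <= 3 / 4 * r.
  apply: le_trans (ler_enormD _ _) _; rewrite enormZ nu1 mulr1.
  rewrite gtr0_norm ?divr_gt0//.
  have := ler_enormD v (- w); rewrite enormN.
  by have := Kx0 Kx; have := bz; rewrite /eball /= -/v -/w; lra.
split=> //.
- by rewrite mulr_gt0// (lt_le_trans _ lb)// divr_gt0.
- by rewrite mulrCA ler_pM2l//; lra.
- by apply: le_trans ub; rewrite ler_piMl// enorm_ge0.
Qed.

Lemma horn_lipschitz_domain : lipschitz_domain Omega.
Proof.
apply: (@star_shaped_lipschitz _ _ (x0 + (r / 2) *: nu) (r / 8)) => //.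
- have [x Kx] := K0; exists (x0 + (r / 2) *: nu).
  exists x, (x0 + (r / 2) *: nu), 1.
  by rewrite /eball /= subrr enorm0 ltr01 lexx scale1r subrKC.
- exact: horn_open.
- apply: (@bounded_enorm _ _ _ (r + enorm x0)) => y.
  case/horn_steep => x [Kx _ _ yx].
  have := ler_enormB y x x0; have := Kx0 Kx.
  have := ler_enormD (y - x0) x0; rewrite subrK.
  by have := r0; lra.
- exact: horn_star_shaped.
Qed.

(** A chord from K is at least twice as steep as E allows at that distance. *)
Lemma horn_disjoint y : E y -> ~ Omega y.
Proof.
move=> Ey /horn_steep[x [Kx pos steep yx]].
have := flat Kx Ey; have := ler_norm (dot (y - x) nu); have := r0; lra.
Qed.

(** A point p of E near a point y of the horn over the vertex x satisfies
    |y - x| <= 7 |y - p|, as y is steep and p is flat seen from x.  So a point of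
    E in the closure of the horn is a limit of vertices. *)
Lemma horn_frontier : E `&` frontier Omega = E `&` closure K.
Proof.
rewrite open_frontier; last exact: horn_open.
apply/seteqP; split=> p [Ep].
  move=> [clp _]; split=> //; apply/closure_eball => e e0.
  move/closure_eball: clp => /(_ (Num.min (e / 8) (r / 4))).
  rewrite lt_min !divr_gt0// => /(_ isT)[y /horn_steep[x [Kx _ steep yx]]].
  (* r / 4 keeps p within r of the vertex, where E is flat. *)
  rewrite lt_min => /andP[ype ypr]; exists x => //.
  have px := ler_enormB p y x; rewrite (enorm_distC p y) in px.
  have := flat Kx Ep; have := ler_norm (dot (p - x) nu).
  have := le_trans (ler_norm _) (dot_nu (y - p)).
  move: steep; have := r0; rewrite !dotBl (enorm_distC x); lra.
move=> clp; split=> //; split; last exact: horn_disjoint.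
apply/closure_eball => e e0.
move/closure_eball: clp => /(_ (e / 2)); rewrite divr_gt0// => /(_ isT)[x Kx xp].
pose t := Num.min 1 (e / (2 * r)).
have t0 : 0 < t by rewrite lt_min ltr01 divr_gt0// mulr_gt0.
have te : t * r <= e / 2.
  apply: (@le_trans _ _ (e / (2 * r) * r)).
    by rewrite ler_pM2r// ge_min lexx orbT.
  by rewrite le_eqVlt; apply/orP; left; apply/eqP; field; rewrite gt_eqF.
exists (x + t *: (x0 + (r / 2) *: nu - x)).
  exists x, (x0 + (r / 2) *: nu), t; split=> //.
    by rewrite /eball /= subrr enorm0.
  by rewrite t0 ge_min lexx.
rewrite addrAC; apply: le_lt_trans (ler_enormD _ _) _.
rewrite enormZ (gtr0_norm t0).
have -> : x0 + (r / 2) *: nu - x = (r / 2) *: nu - (x - x0).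
  by rewrite opprB -addrA addrCA.
have := ler_enormD ((r / 2) *: nu) (- (x - x0)).
rewrite enormN enormZ nu1 mulr1 gtr0_norm ?divr_gt0// => le1.
have /(ler_wpM2l (ltW t0)) : enorm ((r / 2) *: nu - (x - x0)) <= r.
  by have := r0; have := Kx0 Kx; lra.
by have := r0; lra.
Qed.

End FlatPiece.

(** The second domain is the horn in the direction - nu.  A common point of
    the two horns would put a point of K steeply above another one. *)
Lemma two_sided_domains (R : realType) n (E K : set 'rV[R]_n.+1)
    (x0 nu : 'rV[R]_n.+1) (r : R) :
  0 < r -> enorm nu = 1 -> K !=set0 -> K `<=` E ->
  (forall x, K x -> enorm (x - x0) <= r / 8) ->
  (forall x y, K x -> E y -> enorm (y - x) < r ->
    `|dot (y - x) nu| <= enorm (y - x) / 6) ->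
  exists Omega_p Omega_m : set 'rV[R]_n.+1,
    [/\ lipschitz_domain Omega_p, lipschitz_domain Omega_m,
        Omega_p `&` Omega_m = set0,
        E `&` frontier Omega_p = E `&` closure K
      & E `&` frontier Omega_m = E `&` closure K].
Proof.
move=> r0 nu1 K0 KE Kx0 flat.
have Nnu1 : enorm (- nu) = 1 by rewrite enormN.
have Nflat x y : K x -> E y -> enorm (y - x) < r ->
    `|dot (y - x) (- nu)| <= enorm (y - x) / 6.
  by rewrite dotNr normrN; exact: flat.
exists (horn K (x0 + (r / 2) *: nu) (r / 8)).
exists (horn K (x0 + (r / 2) *: (- nu)) (r / 8)); split.
- exact: horn_lipschitz_domain.
- exact: horn_lipschitz_domain.
- rewrite -subset0 => y [/(horn_steep r0 nu1 Kx0)[x [Kx pos steep _]]].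
  move=> /(horn_steep r0 Nnu1 Kx0)[x' [Kx' pos' steep' _]].
  have x'x := ler_enormB x' y x; rewrite (enorm_distC x' y) in x'x.
  have x'x0 := ler_enormB x' x0 x; rewrite (enorm_distC x0) in x'x0.
  have x'xr : enorm (x' - x) < r by have := Kx0 _ Kx; have := Kx0 _ Kx'; lra.
  have := flat x x' Kx (KE _ Kx') x'xr; have := ler_norm (dot (x' - x) nu).
  move: pos pos' steep steep'; rewrite !(dotNr, dotBl); lra.
- exact: horn_frontier.
- exact: horn_frontier.
Qed.

(** * Tangency and lower regularity give a two-sided cone condition *)

Section Tangency.
Context {R : realType}.

Lemma hausdorff_measure_le d n (A B : set 'rV[R]_d) : A `<=` B ->
  (hausdorff_measure n A <= hausdorff_measure n B)%E.
Proof.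
move=> AB; apply: ub_ereal_sup => _ [delta /= delta0 <-].
apply: (@le_trans _ _ (hausdorff_content n delta B)); last first.
  by apply: ereal_sup_ubound; exists delta.
apply: ereal_inf_le_tmp; apply: image_subset => U [Ud BU]; split=> //.
exact: subset_trans BU.
Qed.

Lemma density_ratio_le d n (A B : set 'rV[R]_d) r : 0 <= r -> A `<=` B ->
  (density_ratio n A r <= density_ratio n B r)%E.
Proof.
move=> r0 AB; apply: lee_wpmul2r; last exact: hausdorff_measure_le.
by rewrite lee_fin invr_ge0 exprn_ge0.
Qed.

Lemma density_ratioM d n (A : set 'rV[R]_d) a r :
  (density_ratio n A (a * r) = density_ratio n A r * ((a ^+ n)^-1)%:E)%E.
Proof.
by rewrite /density_ratio -muleA -EFinM exprMn invfM mulrC.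
Qed.

Lemma exists_unit_normal n (V : {vspace 'rV[R]_n.+1}) : (\dim V <= n)%N ->
  exists nu, enorm nu = 1 /\ forall v, v \in V -> dot v nu = 0.
Proof.
move=> dimV; pose M : 'M[R]_(\dim V, n.+1) := \matrix_i (vbasis V)`_i.
have : kermx M^T != 0.
  rewrite kermx_eq0 -row_leq_rank -ltnNge.
  by apply: leq_ltn_trans (rank_leq_col _) _.
case/rowV0Pn => w /sub_kermxP wM w0.
exists ((enorm w)^-1 *: w); split.
  by rewrite enormZ gtr0_norm ?invr_gt0 ?enorm_gt0// mulVf ?gt_eqF ?enorm_gt0.
move=> v /coord_vbasis ->; rewrite dotZr; apply/eqP; rewrite mulf_eq0.
apply/orP; right; rewrite dotC dot_mulmx linear_sum /= mulmx_sumr summxE.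
rewrite big1 // => i _; rewrite linearZ /= -scalemxAr mxE.
have /rowP/(_ i) := wM; rewrite [RHS]mxE => wMi.
suff -> : (w *m ((vbasis V)`_i)^T) 0 0 = 0 by rewrite mulr0.
by rewrite -wMi !mxE; apply: eq_bigr => j _; rewrite !mxE.
Qed.

Lemma dot_le_dist_subspace n (V : {vspace 'rV[R]_n.+1}) nu x :
  enorm nu = 1 -> (forall v, v \in V -> dot v nu = 0) ->
  `|dot x nu| <= dist_subspace x V.
Proof.
move=> nu1 Vnu; apply: lb_le_inf.
  by exists (enorm (x - 0)), 0 => //=; rewrite mem0v.
move=> _ [v /= Vv <-]; have -> : dot x nu = dot (x - v) nu.
  by rewrite dotBl (Vnu v)// subr0.
by apply: le_trans (cauchy_schwarz _ _) _; rewrite nu1 mulr1.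
Qed.

(** If y in E were outside the wider cone of slope 1 / 8, the ball of radius
    |y - x| / 90 around y would miss the cone of slope s < 1 / 9; by lower
    regularity E has measure at least a fixed multiple of |y - x| ^ n in that
    ball, which the tangent condition forbids when y is close to x. *)
Lemma tangent_point_flat n s (E : set 'rV[R]_n.+1) x :
  s < 1 / 9 -> tangent_points n s E x ->
  exists nu r, [/\ enorm nu = 1, 0 < r &
    forall y, E y -> enorm (y - x) < r -> `|dot (y - x) nu| <= enorm (y - x) / 8].
Proof.
move=> s9 [Ex [V [dimV _ tan]] [_ [rho [rho0 reg]]]].
have [nu [nu1 Vnu]] : exists nu, enorm nu = 1 /\
    forall v, v \in V -> dot v nu = 0.
  by apply: exists_unit_normal; rewrite dimV.
have [c c0 creg] : exists2 c : R, 0 < c & forall y t, E y ->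
    enorm (y - x) < rho -> 0 < t < rho ->
    (c%:E <= density_ratio n (eball y t `&` E) t)%E.
  move: reg; set m := ereal_inf _ => m0.
  have [c c0 cm] : exists2 c : R, 0 < c & (c%:E <= m)%E.
    case: m m0 => [c| |] //; last by exists 1; rewrite ?leey.
    by rewrite lte_fin; exists c.
  exists c => // y t Ey yx t0; apply: le_trans cm _.
  by apply: ereal_inf_lbound; exists (y, t).
(* 180 is the ratio of the radius 2 |y - x| to the radius |y - x| / 90. *)
pose eta := c * ((180 ^+ n)^-1).
have eta0 : 0 < eta by rewrite mulr_gt0// invr_gt0 exprn_gt0.
have [r1 r10 small] : exists2 r1 : R, 0 < r1 & forall t, 0 < t < r1 ->
    (density_ratio n ((E `&` eball x t) `\` cone x V s) t < eta%:E)%E.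
  have /tan/nbhs_ballP[r1 /= r10 r1P] : nbhs (0%E : \bar R) [set y | (y < eta%:E)%E].
    by apply: open_nbhs_nbhs; split; [exact: open_ereal_lt_ereal|rewrite /= lte_fin].
  exists r1 => // t /andP[t0 tr1]; apply: r1P => //.
  by rewrite /ball /= sub0r normrN gtr0_norm.
exists nu, (Num.min rho (r1 / 2)); split=> //.
  by rewrite lt_min rho0 divr_gt0.
move=> y Ey; set N := enorm (y - x); rewrite lt_min => /andP[Nrho Nr1].
rewrite leNgt; apply/negP => steep.
have N0 : 0 < N.
  rewrite lt_def enorm_ge0 andbT; apply: contraTneq steep => N0.
  rewrite N0 mul0r -leNgt; apply: le_trans (cauchy_schwarz _ _) _.
  by rewrite -/N N0 mul0r.
have t0 : 0 < N / 90 < rho by rewrite divr_gt0//=; lra.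
have sub : eball y (N / 90) `&` E `<=` (E `&` eball x (2 * N)) `\` cone x V s.
  move=> z [yz Ez]; have zx := ler_enormB z y x.
  move: yz; rewrite /eball /= => yz.
  split; first by split=> //=; rewrite -/N in zx; lra.
  apply/negP; rewrite -leNgt.
  apply: le_trans (dot_le_dist_subspace (z - x) nu1 Vnu).
  have : `|dot (y - x) nu| <= `|dot (z - x) nu| + `|dot (y - z) nu|.
    by apply: le_trans (ler_normD _ _); rewrite -dotDl [z - x + _]addrC subrKA.
  have := cauchy_schwarz (y - z) nu; rewrite nu1 mulr1 (enorm_distC y z).
  have : s * enorm (z - x) <= 1 / 9 * enorm (z - x).
    by rewrite ler_wpM2r ?enorm_ge0// ltW.
  by rewrite -/N in zx; lra.
have N2 : 0 < 2 * N < r1 by rewrite mulr_gt0//=; lra.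
have := density_ratio_le n (ltW (proj1 (andP N2))) sub.
apply/negP; rewrite -ltNge; apply: lt_le_trans (small _ N2) _.
have -> : 2 * N = 180 * (N / 90) by lra.
rewrite density_ratioM /eta EFinM; apply: lee_wpmul2r; last exact: creg.
by rewrite lee_fin invr_ge0 exprn_ge0.
Qed.

End Tangency.

(** * Decomposition into countably many flat pieces *)

(** The cells of a cubic grid of side e / (d + 1), indexed by integer vectors. *)
Lemma integer_grid (R : realType) d (e : R) : 0 < e ->
  exists g : 'rV[R]_d -> 'rV[int]_d,
    forall x y, g x = g y -> enorm (x - y) <= e.
Proof.
move=> e0; pose M := d.+1%:R / e; have M0 : 0 < M by rewrite divr_gt0.
exists (fun x => \row_i Num.floor (x 0 i * M)) => x y /rowP gxy.
have -> : e = d.+1%:R * M^-1 by rewrite /M; field; rewrite gt_eqF//= addrC natr1.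
apply: enorm_le_coord => [|i]; first by rewrite invr_ge0 ltW.
have := gxy i; rewrite !mxE => fl.
rewrite -(ler_pM2r M0) mulVf ?gt_eqF// -{1}(gtr0_norm M0) -normrM mulrBl.
have := floor_itv (x 0 i * M); have := floor_itv (y 0 i * M); rewrite fl.
rewrite intrD ler_norml => /andP[? ?] /andP[? ?]; lra.
Qed.

Theorem theorem1p2 (R : realType) (n : nat) (hn : (1 <= n)%N)
    (E : set 'rV[R]_n.+1) (hE : closed E)
    (s : R) (hs0 : 0 < s) (hs1 : s < 1 / Num.sqrt 90) :
  exists Omega_p Omega_m : nat -> set 'rV[R]_n.+1,
    [/\ forall j, lipschitz_domain (Omega_p j) /\ lipschitz_domain (Omega_m j),
        forall j, Omega_p j `&` Omega_m j = set0,
        forall j, tangent_points n s E `&` frontier (Omega_p j) =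
                  tangent_points n s E `&` frontier (Omega_m j),
        tangent_points n s E `<=` \bigcup_j frontier (Omega_p j)
      & tangent_points n s E `<=` \bigcup_j frontier (Omega_m j)].
Proof.
have s9 : s < 1 / 9.
  apply: lt_le_trans hs1 _; rewrite !div1r lef_pV2 ?posrE ?sqrtr_gt0//.
  rewrite -ler_sqr ?nnegrE// sqr_sqrtr// -natrX ler_nat.
  by [].
set T := tangent_points n s E.
have TE : T `<=` E by move=> x [].
have TI A : T `&` (E `&` A) = T `&` A by rewrite setIA (setIidl TE).
have [[x1 Tx1]|/forallNP T0] := pselect (T !=set0); last first.
  (* Without points to cover, the horns over the origin serve as dummies. *)
  have [nu [nu1 _]] : exists nu : 'rV[R]_n.+1, enorm nu = 1 /\
      forall v, v \in 0%VS -> dot v nu = 0.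
    by apply: exists_unit_normal; rewrite dimv0.
  have [|||||x _ -> ->|Op [Om [lp lm disj _ _]]] :=
    @two_sided_domains R n [set 0] [set 0] 0 nu 1.
  - exact: ltr01.
  - exact: nu1.
  - by exists 0.
  - by [].
  - by move=> x ->; rewrite subrr enorm0 divr_ge0.
  - by move=> _; rewrite subrr -(scale0r 0) dotZl mul0r normr0 divr_ge0 ?enorm_ge0.
  exists (fun=> Op), (fun=> Om); split=> // [j|x /T0|x /T0] //.
  by apply/seteqP; split=> x [/T0].
have /choice[f fP] : forall x, exists p : 'rV[R]_n.+1 * nat, T x ->
    enorm p.1 = 1 /\ forall y, E y -> enorm (y - x) < (p.2.+1%:R)^-1 ->
      `|dot (y - x) p.1| <= enorm (y - x) / 8.
  move=> x.
  have [Tx|nTx] := pselect (T x); last by exists (0, 0%N).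
  have [nu [r [nu1 r0 flat]]] := tangent_point_flat s9 Tx.
  have [k] := ltr_add_invr r0; rewrite add0r => kr.
  exists (nu, k) => _; split=> // y Ey yx; apply: flat => //.
  exact: lt_trans yx kr.
pose nu x := (f x).1; pose k x := (f x).2.
pose r k : R := (k.+1%:R)^-1.
have r0 m : 0 < r m by rewrite invr_gt0.
have [g gP] := choice (fun m => integer_grid n.+1 (divr_gt0 (r0 m) (ltr0Sn R 7))).
(* 1 / 24 is what a change of normal may cost: 1 / 8 + 1 / 24 = 1 / 6. *)
have [h hP] := integer_grid n.+1 (divr_gt0 (@ltr01 R) (ltr0Sn R 23)).
(* Points with the same code form one of the flat pieces. *)
pose code x := pickle (k x, g (k x) x, h (nu x)).
have code_inj x y : code x = code y ->
    [/\ k x = k y, enorm (x - y) <= r (k y) / 8 & enorm (nu x - nu y) <= 1 / 24].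
  move/(pcan_inj pickleK) => -[kxy gxy hxy]; rewrite kxy in gxy.
  by split=> //; [exact: gP | exact: hP].
(* Codes that are not taken repeat some other piece. *)
have /choice[X XP] : forall j, exists x, T x /\
    forall y, T y -> code y = j -> code x = j.
  move=> j.
  have [[x [Tx xj]]|none] := pselect (exists x, T x /\ code x = j).
    by exists x.
  by exists x1; split=> // y Ty yj; case: none; exists y.
pose K j := [set y | T y /\ code y = code (X j)].
have /choice[Om OmP] : forall j, exists P : set 'rV[R]_n.+1 * set 'rV[R]_n.+1,
    [/\ lipschitz_domain P.1, lipschitz_domain P.2, P.1 `&` P.2 = set0,
      E `&` frontier P.1 = E `&` closure (K j)
      & E `&` frontier P.2 = E `&` closure (K j)].
  move=> j.
  have [TX _] := XP j; have [nu1 _] := fP _ TX.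
  have [|||||x y [Tx /code_inj[kx _ nux]] Ey|Op [Om]] :=
    @two_sided_domains R n E (K j) (X j) (nu (X j)) (r (k (X j))).
  - exact: r0.
  - exact: nu1.
  - by exists (X j).
  - by move=> x [/TE].
  - by move=> x [_ /code_inj[]].
  - rewrite -kx => yx; have [_ /(_ y Ey yx) flat] := fP _ Tx.
    have : `|dot (y - x) (nu (X j))| <=
        `|dot (y - x) (nu x)| + `|dot (y - x) (nu x - nu (X j))|.
      by apply: le_trans (ler_normB _ _); rewrite -dotBr subKr.
    have := cauchy_schwarz (y - x) (nu x - nu (X j)).
    have := ler_wpM2l (enorm_ge0 (y - x)) nux.
    by rewrite -/(nu x) in flat; lra.
  - by exists (Op, Om).
have cover j x : T x -> code x = j -> (E `&` closure (K j)) x.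
  move=> Tx xj; split; first exact: TE.
  by have [_ Xj] := XP j; apply: subset_closure; split; rewrite ?(Xj x).
exists (fun j => (Om j).1), (fun j => (Om j).2); split.
- by move=> j; have [] := OmP j.
- by move=> j; have [] := OmP j.
- by move=> j; rewrite -TI -[RHS]TI; have [_ _ _ -> ->] := OmP j.
- move=> x Tx; exists (code x) => //.
  by have := cover _ x Tx erefl; have [_ _ _ <- _] := OmP (code x); case.
- move=> x Tx; exists (code x) => //.
  by have := cover _ x Tx erefl; have [_ _ _ _ <-] := OmP (code x); case.
Qed.
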